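(* Let $m\ge 10$ be an integer and $\beta\ge 1$ be such that $\beta\le\frac{m}{3\ln m}$ and $\beta\ge 2\ln\beta+2\ln\ln m$. Then the utilitarian distortion of the Plurality Veto rule with $m$ candidates under the Plackett–Luce model with parameter $\beta$ satisfies $$\mathcal{D}_{m,\beta}(\mathrm{PluralityVeto})\;\ge\;\frac{\beta\ln m}{6}.$$
   Context: Setting. $C$ is a set of $m$ candidates and $\beta\ge 1$ is a real parameter. Let $\mathcal{V}$ be a probability distribution on $[0,1]^C$ (utility vectors). For each $n$, the utility vectors $\mathbf{u}_1,\dots,\mathbf{u}_n$ of $n$ voters are drawn i.i.d. from $\mathcal{V}$, with $u_{i,j}\in[0,1]$ the utility of voter $i$ for candidate $j$. Given the utilities, each voter $i$ independently submits a random ranking $\pi_i$ of $C$ drawn from the Plackett–Luce model: positions are filled from top to bottom, and at each step a candidate $j$ is chosen among the not yet ranked candidates with probability proportional to $e^{\beta u_{i,j}}$. A voting rule $f$ maps each profile $\pi^n=(\pi_1,\dots,\pi_n)$ (for every $n$) to a probability distribution over $C$; it is deterministic if it always selects a single winner. Put $\mathrm{Util}_j=\mathbb{E}_{\mathbf{u}\sim\mathcal{V}}[u_j]$ and $\mathrm{Util}_n(f)=\mathbb{E}\big[\tfrac1n\sum_{i=1}^n u_{i,f(\pi^n)}\big]$, the expectation being over utilities, rankings and any internal randomness of $f$. The utilitarian distortion is $$\mathcal{D}_{m,\beta}(f)=\sup_{\mathcal{V}}\ \limsup_{n\to\infty}\ \frac{\max_{j\in C}\mathrm{Util}_j}{\mathrm{Util}_n(f)},$$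 with the ratio taken to be $1$ if numerator and denominator are both $0$. Plurality Veto rule. First phase: each voter places one token on the candidate they rank first. Second phase: voters, one at a time in an arbitrary but fixed order, each remove one token from the candidate they rank lowest among the candidates that still have tokens. The candidate with a token remaining after $n-1$ removals wins. *)

(* Defs.v *)
From HB Require Import structures.
From mathcomp Require Import all_boot all_order all_algebra all_fingroup.
From mathcomp Require Import all_classical all_reals all_analysis.

Set Implicit Arguments.
Unset Strict Implicit.
Unset Printing Implicit Defensive.

Import Order.TTheory GRing.Theory Num.Theory.
Import numFieldNormedType.Exports.

Local Open Scope classical_set_scope.
Local Open Scope ring_scope.

(* Candidates are the elements of 'I_m.  A ranking r sends a position
   (0 = top, m - 1 = bottom) to the candidate placed there. *)
Definition ranking (m : nat) : predArgType := {perm 'I_m}.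

Definition position (m : nat) (r : ranking m) (j : 'I_m) : nat :=
  (r^-1)%g j.

Definition profile (m n : nat) : predArgType := {ffun 'I_n -> ranking m}.

(* The law of a random ranking that is filled from top to bottom: position k
   receives r k, and the candidates not ranked yet at that step are those at
   positions l >= k. *)
Definition plackett_luce (R : realType) (m : nat) (beta : R)
    (u : m.-tuple R) (r : ranking m) : R :=
  \prod_(k < m) (expR (beta * tnth u (r k)) /
    \sum_(l < m | (k <= l)%N) expR (beta * tnth u (r l))).

(* The n-fold product probability on n.-tuple T: the law of n i.i.d. draws. *)
Section iid.
Context d (T : measurableType d) (R : realType).

Definition tuple_cons (n : nat) (p : T * n.-tuple T) : n.+1.-tuple T :=
  [the n.+1.-tuple T of p.1 :: p.2].

Lemma measurable_tuple_cons (n : nat) :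
  measurable_fun [set: T * n.-tuple T] (@tuple_cons n).
Proof. exact: measurable_cons measurable_fst measurable_snd. Qed.

HB.instance Definition _ (n : nat) :=
  isMeasurableFun.Build _ _ _ _ (@tuple_cons n) (@measurable_tuple_cons n).

Fixpoint iid (P : probability T R) (n : nat) : probability (n.-tuple T) R :=
  if n is n'.+1 then distribution (P \x iid P n')%E (@tuple_cons n')
  else dirac [tuple].

Lemma iid_box (P : probability T R) (n : nat) (A : 'I_n -> set T) :
  (forall i, measurable (A i)) ->
  (iid P n [set u | forall i, A i (tnth u i)] = \prod_(i < n) P (A i))%E.
Proof.
elim: n A => [|n IHn] A mA.
  rewrite big_ord0 /= diracE mem_set//= => -[].
  by [].
rewrite big_ord_recl -IHn; last by move=> i; exact: mA.
rewrite -product_measure1E//; last first.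
  rewrite (_ : mkset _ = \bigcap_(i in [set: 'I_n])
    ((fun u : n.-tuple T => tnth u i) @^-1` A (lift ord0 i))); last first.
    by apply/seteqP; split=> u /= h i; [move=> _; exact: h|exact: h].
  apply: fin_bigcap_measurable => // i _.
  by rewrite -[X in measurable X]setTI; exact: measurable_tnth.
rewrite /= /distribution /pushforward; congr (product_measure1 _ _ _).
apply/seteqP; split=> -[x u] /= => [h|[h0 h] i].
  split; first exact: (h ord0).
  by move=> i; have := h (lift ord0 i); rewrite tnthS.
have [->//|i0] := eqVneq i ord0.
case: (unliftP ord0 i) i0 => [j ->|->]; last by rewrite eqxx.
by rewrite tnthS.
Qed.

End iid.

Record lottery (R : realType) (m : nat) := Lottery {
  lottery_prob :> 'I_m -> R ;
  lottery_ge0 : forall j, 0 <= lottery_prob j ;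
  lottery_sum1 : \sum_(j < m) lottery_prob j = 1 }.

(* Electorates are nonempty: the size of the profile is n.+1. *)
Definition voting_rule (R : realType) (m : nat) :=
  forall n, profile m n.+1 -> lottery R m.

Definition deterministic_rule (m : nat) := forall n, profile m n.+1 -> 'I_m.

Section dirac_lottery.
Variables (R : realType) (m : nat) (w : 'I_m).

Let prob (j : 'I_m) : R := (j == w)%:R.

Let prob_ge0 j : 0 <= prob j. Proof. exact: ler0n. Qed.

Let prob_sum1 : \sum_(j < m) prob j = 1.
Proof.
rewrite (bigD1 w)//= big1 /prob ?eqxx ?addr0// => j.
by move=> /negbTE ->.
Qed.

Definition dirac_lottery : lottery R m := Lottery prob_ge0 prob_sum1.

End dirac_lottery.

Definition rule_of_deterministic (R : realType) (m : nat)
    (f : deterministic_rule m) : voting_rule R m :=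
  fun n p => dirac_lottery R (f n p).

Section plurality_veto.
Variable m : nat.
Implicit Types (t : {ffun 'I_m -> nat}) (r : ranking m).

Definition plurality_tokens (n : nat) (p : profile m n) : {ffun 'I_m -> nat} :=
  [ffun j => #|[pred i : 'I_n | position (p i) j == 0%N]|].

Definition lowest_with_token t r (j : 'I_m) : bool :=
  (0 < t j)%N &&
  [forall k : 'I_m, (0 < t k)%N ==> (position r k <= position r j)%N].

Definition veto t r : {ffun 'I_m -> nat} :=
  [ffun j => (t j - lowest_with_token t r j)%N].

(* Voters veto in the order s ord0, s 1, ...; only the first n of the n.+1
   voters get to remove a token. *)
Definition tokens_left (n : nat) (s : 'S_n.+1) (p : profile m n.+1) :
    {ffun 'I_m -> nat} :=
  foldl veto (plurality_tokens p) (take n [seq p (s i) | i <- enum 'I_n.+1]).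

Context (m_gt0 : (0 < m)%N).

Lemma plurality_tokens_sum (n : nat) (p : profile m n) :
  (\sum_(j < m) plurality_tokens p j = n)%N.
Proof.
pose top (i : 'I_n) : 'I_m := p i (Ordinal m_gt0).
rewrite -[RHS]card_ord -sum1_card (partition_big top xpredT)//=.
apply: eq_bigr => j _; rewrite ffunE -sum1_card; apply: eq_bigl => i.
rewrite inE /position /top; apply/eqP/eqP => [h|<-]; last by rewrite permK.
by rewrite -[RHS](permKV (p i)); congr (p i _); apply: val_inj.
Qed.

Lemma veto_sum t r : (0 < \sum_(j < m) t j)%N ->
  (\sum_(j < m) veto t r j = (\sum_(j < m) t j).-1)%N.
Proof.
rewrite lt0n sum_nat_eq0 negb_forall => /existsP[k0]; rewrite /= -lt0n => tk0.
have [j tj jmax] := @arg_maxnP _ k0 (fun k => 0 < t k)%N (position r) tk0.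
have lowj : lowest_with_token t r j.
  by rewrite /lowest_with_token tj; apply/forallP => k; apply/implyP/jmax.
rewrite (bigD1 j)//= [in RHS](bigD1 j)//= ffunE lowj subn1.
rewrite (eq_bigr t) => [|k kj]; first by case: (t j) tj.
rewrite ffunE; case: (boolP (lowest_with_token _ _ k)); last by rewrite subn0.
move=> /andP[tk /forallP/(_ j)]; rewrite tj/= => jk.
have /eqP := anti_leq (introT andP (conj (jmax _ tk) jk)).
by move=> /eqP/val_inj/perm_inj kj'; rewrite kj' eqxx in kj.
Qed.

Lemma tokens_left_sum (n : nat) (s : 'S_n.+1) (p : profile m n.+1) :
  (\sum_(j < m) tokens_left s p j = 1)%N.
Proof.
have foldlE rs t : (size rs < \sum_(j < m) t j)%N ->
    (\sum_(j < m) foldl veto t rs j = \sum_(j < m) t j - size rs)%N.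
  elim: rs t => [|r rs IH] t /=; first by rewrite subn0.
  move=> lt_t; have t_gt0 := leq_trans (ltn0Sn _) lt_t.
  rewrite IH veto_sum//; first by rewrite -subn1 -subnDA add1n.
  by rewrite -ltnS prednK.
have size_n : size (take n [seq p (s i) | i <- enum 'I_n.+1]) = n.
  by rewrite size_takel// size_map size_enum_ord.
by rewrite foldlE size_n plurality_tokens_sum// subSnn.
Qed.

Lemma token_left (n : nat) (s : 'S_n.+1) (p : profile m n.+1) :
  exists j, (0 < tokens_left s p j)%N.
Proof.
have : (\sum_(j < m) tokens_left s p j != 0)%N by rewrite tokens_left_sum.
rewrite sum_nat_eq0 negb_forall => /existsP[j]; rewrite /= -lt0n.
by exists j.
Qed.

(* By tokens_left_sum the candidate chosen here is the only one left. *)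
Definition plurality_veto (order : forall n, 'S_n.+1) : deterministic_rule m :=
  fun n p => xchoose (token_left (order n) p).

End plurality_veto.

Section distortion.
Variables (R : realType) (m : nat).
Implicit Types (V : probability (m.-tuple R) R) (f : voting_rule R m).

Definition unit_cube : set (m.-tuple R) :=
  [set u | forall j, 0 <= tnth u j <= 1].

Definition util_cand V (j : 'I_m) : \bar R := 'E_V[fun u => tnth u j]%E.

Definition mean_util (n : nat) (us : n.-tuple (m.-tuple R)) (j : 'I_m) : R :=
  n%:R^-1 * \sum_(i < n) tnth (tnth us i) j.

(* Conditional expectation of the mean utility of the winner given the
   utilities us: the voters rank independently, and the profile p is mapped
   to candidate j with probability f n p j. *)
Definition cond_util_rule (beta : R) f (n : nat)
    (us : n.+1.-tuple (m.-tuple R)) : R :=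
  \sum_(p : profile m n.+1)
    (\prod_(i < n.+1) plackett_luce beta (tnth us i) (p i)) *
    \sum_(j < m) f n p j * mean_util us j.

Definition util_rule (beta : R) V f (n : nat) : \bar R :=
  'E_(iid V n.+1)[@cond_util_rule beta f n]%E.

(* Only the case 0 / 0 needs a convention: x / 0 is +oo when x > 0. *)
Definition util_ratio (x y : \bar R) : \bar R :=
  (if (x == 0) && (y == 0) then 1 else x / y)%E.

Definition asymptotic_ratio (beta : R) f V : \bar R :=
  limn_esup (fun n =>
    util_ratio (\big[maxe/-oo%E]_(j < m) util_cand V j) (util_rule beta V f n)).

Definition distortion (beta : R) f : \bar R :=
  ereal_sup [set asymptotic_ratio beta f V |
    V in [set V : probability (m.-tuple R) R | V unit_cube = 1%E]].

End distortion.

(* Main.v *)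
Require Import Defs.
From HB Require Import structures.
From mathcomp Require Import all_boot all_order all_algebra all_fingroup.
From mathcomp Require Import all_classical all_reals all_analysis.
From mathcomp Require Import measurable_realfun.
From mathcomp Require Import ring lra.

(* Write L = ln m and B = beta L.  With probability q = 3/(2B) a voter gives
   utility 0 to candidate 0 and 1 to all others; otherwise she gives 1/2 to
   candidate 0, 1 to one uniformly random other candidate, and 0 to the rest.
   Since e^(beta/2) >= B, candidate 0 is ranked first with probability at most
   1/B, whereas voters of the first kind rank it last with probability at least
   1 - (1 + L)/e^beta >= 13/16.  So candidate 0 gets fewer plurality tokens than
   vetoes and loses with probability tending to 1.  Every other candidate has
   expected utility q + (1-q)/(m-1) = O(1/B), because B <= m/3, against
   (1-q)/2 for candidate 0.  The events "candidate 0 wins" and "the mean utility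
   of j exceeds its expectation by eps" are controlled by exponential moments,
   which factor over the voters. *)

Set Implicit Arguments.
Unset Strict Implicit.
Unset Printing Implicit Defensive.

Import Order.TTheory GRing.Theory Num.Theory.
Import numFieldNormedType.Exports.

Local Open Scope classical_set_scope.
Local Open Scope ring_scope.

(** * Plackett-Luce weights *)

(** Splits a ranking into its top candidate and a ranking of the others, renumbered along [lift];
    the inductions on the number of candidates rest on it. *)
Lemma lift_perm_bij n : bijective (fun p : 'I_n.+1 * 'S_n => lift_perm ord0 p.1 p.2).
Proof.
apply: inj_card_bij.
  move=> [i s] [i' s'] /= e.
  have ei : i = i' by have := congr1 (fun f : 'S_n.+1 => f ord0) e; rewrite !lift_perm_id.
  subst i'; congr pair; apply/permP => k; apply: (@lift_inj _ i).
  by have := congr1 (fun f : 'S_n.+1 => f (lift ord0 k)) e; rewrite !lift_perm_lift.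
by rewrite card_prod card_Sn card_ord card_Sn factS.
Qed.

Lemma sum_perm_recl (R : nmodType) n (F : 'S_n.+1 -> R) :
  \sum_r F r = \sum_i \sum_(s : 'S_n) F (lift_perm ord0 i s).
Proof.
by rewrite pair_bigA /= (reindex (fun p => lift_perm ord0 p.1 p.2)) //;
  apply: onW_bij; exact: lift_perm_bij.
Qed.

Section weights.
Variable R : realFieldType.

(** The weights are arbitrary, in place of [expR (beta * u)], so that removing the top candidate
    stays within the same model. *)
Definition ranking_weight n (w : 'I_n -> R) (r : 'S_n) : R :=
  \prod_(k < n) (w (r k) / \sum_(l < n | (k <= l)%N) w (r l)).

Lemma ranking_weight_lift n (w : 'I_n.+1 -> R) i (s : 'S_n) :
  ranking_weight w (lift_perm ord0 i s) =
  w i / (\sum_l w l) * ranking_weight (w \o lift i) s.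
Proof.
rewrite /ranking_weight big_ord_recl lift_perm_id; congr (_ / _ * _).
  by rewrite [RHS](reindex_inj (@perm_inj _ (lift_perm ord0 i s))).
apply: eq_bigr => k _; rewrite lift_perm_lift; congr (_ / _).
rewrite big_mkcond big_ord_recl /= add0r -big_mkcond /=.
by apply: eq_big => [l|l _]; rewrite ?lift_perm_lift.
Qed.

Lemma ranking_weight_ge0 n (w : 'I_n -> R) r :
  (forall i, 0 <= w i) -> 0 <= ranking_weight w r.
Proof.
by move=> w0; apply: prodr_ge0 => k _; rewrite divr_ge0 ?w0 ?sumr_ge0.
Qed.

Lemma sum_ranking_weight n (w : 'I_n -> R) :
  (forall i, 0 < w i) -> \sum_r ranking_weight w r = 1.
Proof.
elim: n w => [|n IHn] w w0.
  rewrite (eq_bigr (fun=> 1)) => [|r _]; last by rewrite /ranking_weight big_ord0.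
  by rewrite sumr_const cardT -cardE card_Sn.
rewrite sum_perm_recl.
under eq_bigr => i _.
  under eq_bigr do rewrite ranking_weight_lift.
  rewrite -mulr_sumr IHn ?mulr1 => [|j]; last exact: w0.
  over.
rewrite -mulr_suml divff// gt_eqF// big_ord_recl ltr_wpDr ?w0// sumr_ge0// => j _.
exact: ltW.
Qed.

Lemma sum_ranking_weight_first n (w : 'I_n.+1 -> R) g :
  (forall i, 0 < w i) ->
  \sum_r ranking_weight w r * (r ord0 == g)%:R = w g / \sum_l w l.
Proof.
move=> w0; rewrite sum_perm_recl (bigD1 g) //= [X in _ + X]big1 ?addr0 => [|i ig].
  rewrite -[RHS]mulr1 -[X in _ = _ * X](@sum_ranking_weight _ (w \o lift g)) => [|j]; last exact: w0.
  rewrite mulr_sumr; apply: eq_bigr => s _.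
  by rewrite lift_perm_id eqxx mulr1 ranking_weight_lift.
by apply: big1 => s _; rewrite lift_perm_id (negPf ig) mulr0.
Qed.

(** Union bound over the draws: while [i] other candidates remain, [g] is drawn next with
    probability at most 1/(i W). The induction removes the top candidate. *)
Lemma sum_ranking_weight_last n (w : 'I_n.+1 -> R) g (W : R) :
  0 < W -> (forall i, 0 < w i) -> (forall i, i != g -> w g * W <= w i) ->
  1 - (\sum_(1 <= i < n.+1) i%:R^-1) / W <=
  \sum_r ranking_weight w r * (r ord_max == g)%:R.
Proof.
move=> W0; elim: n w g => [|n IHn] w g w0 wg.
  rewrite (eq_bigr (ranking_weight w)) => [|r _].
    by rewrite sum_ranking_weight// big_nil mul0r subr0.
  by rewrite !ord1 eqxx mulr1.
(* There are at least two candidates here, so [g] on top is not at the bottom and its term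
   vanishes. *)
rewrite sum_perm_recl (bigD1 g)//= [X in _ <= X + _]big1 ?add0r => [|s _]; last first.
  rewrite (_ : ord_max = lift ord0 ord_max); last exact/val_inj.
  by rewrite lift_perm_lift eq_sym (negbTE (neq_lift _ _)) mulr0.
set S := \sum_l w l.
have S0 : 0 < S.
  by rewrite /S big_ord_recl ltr_wpDr ?w0// sumr_ge0// => j _; exact: ltW.
set h := \sum_(1 <= i < n.+1) _ in IHn *.
have step i : i != g -> w i / S * (1 - h / W) <=
    \sum_s ranking_weight w (lift_perm ord0 i s) *
      (lift_perm ord0 i s ord_max == g)%:R.
  move=> ig; case: (unliftP i g) => [g' eg|eg]; last by rewrite eg eqxx in ig.
  rewrite [leRHS](_ : _ = w i / S * \sum_s ranking_weight (w \o lift i) s *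
      (s ord_max == g')%:R); last first.
    rewrite mulr_sumr; apply: eq_bigr => s _.
    rewrite ranking_weight_lift (_ : ord_max = lift ord0 ord_max); last exact/val_inj.
    by rewrite lift_perm_lift eg (inj_eq (@lift_inj _ i)) -mulrA.
  apply: ler_wpM2l; first by rewrite divr_ge0 ?ltW.
  apply: IHn => [j|j jg'] /=; first exact: w0.
  by rewrite -eg; apply: wg; rewrite eg (inj_eq (@lift_inj _ i)).
apply: (@le_trans _ _ (\sum_(i | i != g) w i / S * (1 - h / W))); last first.
  by apply: ler_sum => i ig; exact: step.
rewrite -mulr_suml -mulr_suml.
have eS : S = w g + \sum_(i | i != g) w i by rewrite /S (bigD1 g).
have ge : (n.+1)%:R * (w g * W) <= \sum_(i | i != g) w i.
  rewrite (le_trans _ (ler_sum _ (fun i ig => wg i ig)))// sumr_const mulr_natl.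
  by rewrite cardC1 card_ord.
have wS : w g / S <= n.+1%:R^-1 / W.
  rewrite ler_pdivrMr// -ler_pdivrMl ?mulr_gt0 ?invr_gt0// ?ltr0Sn//.
  rewrite invfM !invrK mulrAC mulrC mulrCA (mulrC W).
  by rewrite eS (le_trans ge)// lerDr ltW.
have -> : \sum_(i | i != g) w i = S - w g by rewrite eS addrC addKr.
rewrite mulrBl divff ?gt_eqF// big_nat_recr//= -/h mulrDl.
have : 0 <= w g / S by rewrite divr_ge0 ?ltW.
have : 0 <= h / W by rewrite divr_ge0 ?(ltW W0)// sumr_ge0// => i _; rewrite invr_ge0.
move: wS; set a := w g / S; set b := n.+1%:R^-1 / W; set x := h / W => ab x0 a0.
(* The goal is now (1 - a)(1 - x) >= 1 - (x + b), which follows from a <= b and a x >= 0. *)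
have : 0 <= a * x by rewrite mulr_ge0.
by lra.
Qed.

End weights.

(** * Vetoes *)

Section veto.
Variable n : nat.
Implicit Types (t : {ffun 'I_n.+1 -> nat}) (r : ranking n.+1).

(** Truncated subtraction covers a bottom candidate without tokens: both sides are then 0. *)
Lemma veto_bottom t r : (veto t r (r ord_max) = t (r ord_max) - 1)%N.
Proof.
rewrite ffunE /lowest_with_token; case: posnP => [->|_] //=.
rewrite (introT forallP)// => k; apply/implyP => _.
by rewrite /position permK -ltnS.
Qed.

Lemma veto_le t r j : (veto t r j <= t j)%N.
Proof. by rewrite ffunE leq_subr. Qed.

Lemma foldl_veto_le g (rs : seq (ranking n.+1)) t :
  (foldl (@veto n.+1) t rs g <= t g - count (fun r => r ord_max == g) rs)%N.
Proof.
elim: rs t => [|r rs IH] t /=; first by rewrite subn0.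
apply: leq_trans (IH _) _; rewrite subnDA leq_sub2r//.
case: eqVneq => [<-|_]; first by rewrite veto_bottom.
by rewrite subn0 veto_le.
Qed.

(** The winner keeps a token, so its first places strictly outnumber its last places among the
    voters who veto. *)
Lemma plurality_veto_wins (m_gt0 : (0 < n.+1)%N) (order : forall N, 'S_N.+1)
    N (p : profile n.+1 N.+1) g :
  plurality_veto m_gt0 order p = g ->
  (\sum_(i < N.+1) (p i ord_max == g) <= \sum_(i < N.+1) (p i ord0 == g))%N.
Proof.
move=> pg; have /= := xchooseP (token_left m_gt0 (order N) p).
rewrite -/(plurality_veto m_gt0 order p) pg /tokens_left => g_token.
have := leq_trans g_token (foldl_veto_le _ _ _).
rewrite subn_gt0 ffunE => lt_top.
have -> : (\sum_(i < N.+1) (p i ord0 == g))%N =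
    #|[pred i : 'I_N.+1 | position (p i) g == 0%N]|.
  rewrite -sum1_card [RHS]big_mkcond /=; apply: eq_bigr => i _.
  rewrite inE /position (_ : (_ == 0%N) = (p i ord0 == g)); first by case: eqP.
  apply/eqP/eqP => [h|<-]; last by rewrite permK.
  by rewrite -[RHS](permKV (p i)); congr (p i _); exact: val_inj.
apply: leq_trans lt_top.
pose s := [seq p (order N i) | i <- enum 'I_N.+1].
have -> : (\sum_(i < N.+1) (p i ord_max == g))%N =
    count (fun r : ranking n.+1 => r ord_max == g) s.
  rewrite (reindex_inj (@perm_inj _ (order N))) /= -sumn_count.
  by rewrite /s -map_comp sumnE big_map big_enum.
(* The last voter in the order casts no veto; her possible last place for [g] is absorbed by the
   strict inequality. *)
rewrite -[s in X in (X <= _)%N](cat_take_drop N) count_cat -[leqRHS]addn1 leq_add2l.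
by rewrite (leq_trans (count_size _ _))// size_drop size_map size_enum_ord subSnn.
Qed.

End veto.

(** * Finitely supported laws *)

(** Separates positive and negative parts, because later integrands are known to be nonnegative only
    on the support of the law. *)
Lemma integral_max0 d (T : measurableType d) (R : realType)
    (P : probability T R) (F : T -> R) :
  (\int[P]_x (F x)%:E =
  \int[P]_x (Num.max (F x) 0)%:E - \int[P]_x (Num.max (- F x) 0)%:E)%E.
Proof.
rewrite integralE; congr (_ - _)%E; apply: eq_integral => x _.
  by rewrite funeposE EFin_max.
by rewrite funenegE EFin_max EFinN.
Qed.

Section discrete.
Context d (T : measurableType d) (R : realType).
Variables (m : nat) (w : nat -> {nonneg R}) (v : nat -> T).

Definition discrete_measure :=
  msum (fun k => mscale (w k) (dirac (v k) : {measure set T -> \bar R})) m.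

HB.instance Definition _ := Measure.on discrete_measure.

Hypothesis w_sum1 : \sum_(k < m) (w k)%:num = 1.

Let discrete_measure_setT : discrete_measure setT = 1%E.
Proof.
rewrite /discrete_measure /msum /=.
under eq_bigr do rewrite /mscale /= diracT mule1.
by rewrite sumEFin w_sum1.
Qed.

(* The unused proof argument lets the probability instance be keyed on a constant
   that records that the weights sum to 1. *)
Definition discrete_prob_of (_ : \sum_(k < m) (w k)%:num = 1) := discrete_measure.
HB.instance Definition _ := Measure.on (discrete_prob_of w_sum1).
HB.instance Definition _ := @Measure_isProbability.Build _ T R
  (discrete_prob_of w_sum1) discrete_measure_setT.
Definition discrete_probability : probability T R := discrete_prob_of w_sum1.

Local Open Scope ereal_scope.

Lemma ge0_integral_discrete (f : T -> \bar R) :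
  measurable_fun [set: T] f -> (forall x, 0 <= f x) ->
  \int[discrete_probability]_x f x = \sum_(k < m) (w k)%:num%:E * f (v k).
Proof.
move=> mf f0; rewrite ge0_integral_measure_sum//; apply: eq_bigr => k _.
by rewrite ge0_integral_mscale// integral_dirac// diracT mul1e.
Qed.

Lemma integral_discrete (f : T -> R) :
  measurable_fun [set: T] f -> (forall k, (k < m)%N -> 0 <= f (v k))%R ->
  \int[discrete_probability]_x (f x)%:E = (\sum_(k < m) (w k)%:num * f (v k))%:E.
Proof.
move=> mf f0; rewrite integral_max0 !ge0_integral_discrete; first last.
- by move=> x; rewrite lee_fin le_max lexx orbT.
- by apply/measurable_EFinP; exact: measurable_maxr.
- by move=> x; rewrite lee_fin le_max lexx orbT.
- by apply/measurable_EFinP/measurable_maxr => //; exact: measurable_funN.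
rewrite [X in _ - X]big1 => [|k _]; last by rewrite max_r ?mule0// oppr_le0 f0.
by rewrite sube0 -sumEFin; apply: eq_bigr => k _; rewrite max_l ?f0.
Qed.

Local Close Scope ereal_scope.

(** Expectation under [n] independent draws as a nested finite sum, following the recursion of
    [iid]. *)
Fixpoint iid_sum n : (n.-tuple T -> R) -> R :=
  match n with
  | 0 => fun F => F [tuple]
  | n'.+1 => fun F =>
      \sum_(k < m) (w k)%:num * iid_sum (fun us => F [tuple of v k :: us])
  end.

Lemma ge0_integral_iid n (F : n.-tuple T -> R) :
  measurable_fun [set: _] F -> (forall x, 0 <= F x) ->
  (\int[iid discrete_probability n]_x (F x)%:E = (iid_sum F)%:E)%E.
Proof.
elim: n F => [|n IHn] F mF F0 /=.
  by rewrite integral_dirac// ?diracT ?mul1e//; exact/measurable_EFinP.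
rewrite ge0_integral_distribution//=; last exact/measurable_EFinP.
have mcons : measurable_fun [set: _] (EFin \o F \o @tuple_cons _ T n).
  by apply: measurableT_comp; [exact/measurable_EFinP|exact: measurable_tuple_cons].
rewrite fubini_tonelli1//=; last by move=> y; rewrite lee_fin.
rewrite ge0_integral_discrete; last 2 first.
- by apply: measurable_fun_fubini_tonelli_F => // x; rewrite /= lee_fin.
- by move=> x; apply: integral_ge0 => y _; rewrite /= lee_fin.
rewrite -sumEFin; apply: eq_bigr => k _; rewrite EFinM; congr (_ * _)%E.
rewrite /fubini_F /= IHn//.
apply: (measurableT_comp mF).
  rewrite /tuple_cons.
  exact: (measurable_cons (@measurable_cst _ _ _ _ setT (v k)) (@measurable_id _ _ setT)).
Qed.

Lemma le_iid_sum n (F G : n.-tuple T -> R) :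
  (forall us, (forall i, exists2 k, (k < m)%N & tnth us i = v k) -> F us <= G us) ->
  iid_sum F <= iid_sum G.
Proof.
elim: n F G => [|n IHn] F G FG /=; first by apply: FG => -[].
apply: ler_sum => k _; rewrite ler_wpM2l// IHn// => us us_v; apply: FG => i.
by case: (unliftP ord0 i) => [j|] ->; rewrite ?tnthS ?tnth0//; exists k.
Qed.

Lemma iid_sum_sum n (I : Type) (s : seq I) (F : I -> n.-tuple T -> R) :
  iid_sum (fun us => \sum_(j <- s) F j us) = \sum_(j <- s) iid_sum (F j).
Proof.
elim: n F => [|n IHn] F //=; rewrite exchange_big; apply: eq_bigr => k _.
by rewrite IHn mulr_sumr.
Qed.

Lemma iid_sumD n (F G : n.-tuple T -> R) :
  iid_sum (fun us => F us + G us) = iid_sum F + iid_sum G.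
Proof.
elim: n F G => [|n IHn] F G //=; rewrite -big_split; apply: eq_bigr => k _.
by rewrite IHn mulrDr.
Qed.

(** Independence turns the expectation of the product into a power; [c] is general so that the
    induction can absorb the factor of the first draw. *)
Lemma iid_sum_prod n c (h : T -> R) :
  iid_sum (fun us : n.-tuple T => c * \prod_(i < n) h (tnth us i)) =
  c * (\sum_(k < m) (w k)%:num * h (v k)) ^+ n.
Proof.
elim: n c => [|n IHn] c /=; first by rewrite big_ord0 expr0.
rewrite exprS mulrCA mulr_suml; apply: eq_bigr => k _.
have -> : (fun us : n.-tuple T => c * \prod_(i < n.+1) h (tnth [tuple of v k :: us] i)) =
    fun us => (c * h (v k)) * \prod_(i < n) h (tnth us i).
  apply/funext => us; rewrite big_ord_recl tnth0 mulrA; congr (_ * _).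
  by apply: eq_bigr => i _; rewrite tnthS.
by rewrite IHn; ring.
Qed.

Lemma iid_sum_cst n (c : R) : iid_sum (fun _ : n.-tuple T => c) = c.
Proof.
have := iid_sum_prod n c (fun=> 1).
under [in X in X = _ -> _]eq_fun do rewrite prodr_const expr1n mulr1.
by move=> ->; under eq_bigr do rewrite mulr1; rewrite w_sum1 expr1n mulr1.
Qed.

(** The conditional utility may be negative outside the unit cube, so signs are constrained only on
    tuples of atoms; [iid_sum] evaluates at no others. *)
Lemma integral_iid n (F : n.-tuple T -> R) : measurable_fun [set: _] F ->
  (forall us, (forall i, exists2 k, (k < m)%N & tnth us i = v k) -> 0 <= F us) ->
  (\int[iid discrete_probability n]_x (F x)%:E = (iid_sum F)%:E)%E.
Proof.
move=> mF F0; rewrite integral_max0 !ge0_integral_iid; first last.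
- by move=> x; rewrite le_max lexx orbT.
- exact: measurable_maxr.
- by move=> x; rewrite le_max lexx orbT.
- by apply: measurable_maxr => //; exact: measurable_funN.
rewrite -EFinB; congr EFin; rewrite -[RHS]subr0; congr (_ - _).
  by apply/le_anti/andP; split; apply: le_iid_sum => us /F0 F0us; rewrite max_l.
rewrite -[RHS](iid_sum_cst n); apply/le_anti/andP.
by split; apply: le_iid_sum => us /F0 F0us; rewrite max_r// oppr_le0.
Qed.

End discrete.

(** * Measurability of the conditional utility *)

Lemma measurable_plackett_luce (R : realType) m (beta : R) (r : ranking m) :
  measurable_fun [set: _] (fun u : m.-tuple R => plackett_luce beta u r).
Proof.
have mexp (l : 'I_m) : measurable_fun [set: _] (fun u : m.-tuple R => expR (beta * tnth u l)).
  apply: measurableT_comp => //; apply: measurable_funM => //.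
  exact: measurable_tnth.
apply: measurable_prod => k _.
(* The denominator is positive, so its inverse is [expR (- ln _)], a composition of measurable
   functions. *)
rewrite [X in measurable_fun _ X](_ : _ = fun u : m.-tuple R =>
  expR (beta * tnth u (r k)) *
  expR (- ln (\sum_(l < m | (k <= l)%N) expR (beta * tnth u (r l))))); last first.
  apply/funext => u; rewrite expRN lnK// posrE (bigD1 k)//=.
  by rewrite ltr_pwDl ?expR_gt0// sumr_ge0// => l _; exact: expR_ge0.
apply: measurable_funM => //; apply: measurableT_comp => //.
apply: measurable_funN; apply: measurableT_comp => //.
under eq_fun do rewrite big_mkcond.
by apply: measurable_sum => l; case: (k <= l)%N.
Qed.

Lemma measurable_cond_util_rule (R : realType) m (beta : R) (f : voting_rule R m) n :
  measurable_fun [set: _] (@cond_util_rule R m beta f n).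
Proof.
apply: measurable_sum => p; apply: measurable_funM.
  apply: measurable_prod => i _.
  exact: (measurableT_comp (measurable_plackett_luce beta (p i)) (measurable_tnth i)).
apply: measurable_sum => j; apply: measurable_funM => //.
apply: measurable_funM => //; apply: measurable_sum => i.
exact: (measurableT_comp (measurable_tnth j) (measurable_tnth i)).
Qed.

(** * Real estimates *)

Section numerics.
Variable R : realType.
Implicit Types x y beta : R.

Lemma ln_ge_1subV x : 0 < x -> 1 - x^-1 <= ln x.
Proof.
move=> x0; have := @le_ln1Dx R (x^-1 - 1).
rewrite addrCA subrr addr0 lnV ?posrE// lerNl opprB; apply.
by rewrite ltrDr invr_gt0.
Qed.

Lemma ln_nat_gt2 m : (10 <= m)%N -> 2 < ln m%:R :> R.
Proof.
move=> m10; rewrite -(expRK 2) ltr_ln ?posrE ?expR_gt0 ?ltr0n//; last exact: leq_trans m10.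
have m10R : 10%:R <= m%:R :> R by rewrite ler_nat.
apply: lt_le_trans m10R.
(* The 16th power of e^(-1/8) >= 7/8 gives e^(-2) > 0.118 > 1/10, hence e^2 < 10. *)
have e8 : (7 / 8) ^+ 16 <= expR (- 2) :> R.
  rewrite (_ : -2 = 16%:R * - 8^-1); last by field.
  have e1 : 7 / 8 <= expR (- 8^-1) :> R by apply: le_trans (expR_ge1Dx _); lra.
  by rewrite expRM_natl lerXn2r// nnegrE ?expR_ge0//; lra.
have := expRxMexpNx_1 (2 : R); have := expR_gt0 (2 : R).
move: e8; set a := expR (-2); set b := expR 2 => e8 b0 ab.
by nra.
Qed.

(** Each new term satisfies 1/(k+1) <= ln ((k+1)/k), by 1 - 1/x <= ln x at x = (k+1)/k. *)
Lemma sum_inv_le_ln n : \sum_(1 <= i < n.+2) i%:R^-1 <= 1 + ln n.+1%:R :> R.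
Proof.
elim: n => [|n IHn]; first by rewrite big_nat1 ln1 invr1 addr0.
rewrite big_nat_recr//= -[X in 1 + ln X](@divfK _ n.+1%:R) ?pnatr_eq0//.
rewrite lnM ?posrE ?divr_gt0 ?ltr0n// addrCA addrC lerD//.
apply: le_trans (ln_ge_1subV _); last by rewrite divr_gt0 ?ltr0n.
rewrite invf_div lerBrDr -[X in X + _]mul1r -mulrDl.
by rewrite ler_pdivrMr ?ltr0n// mul1r (_ : 1 + _ = n.+2%:R)// -[LHS](natrD _ 1 n.+1).
Qed.

Lemma expR_half_ge beta L : 0 < beta -> 0 < L -> 2 * ln beta + 2 * ln L <= beta ->
  beta * L <= expR (beta / 2).
Proof.
move=> b0 L0 h; have BL0 : 0 < beta * L by rewrite mulr_gt0.
by rewrite -[leLHS]lnK ?posrE// ler_expR lnM ?posrE//; lra.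
Qed.

Lemma two_lt_beta beta L : 1 <= beta -> 2 < L -> 2 * ln beta + 2 * ln L <= beta ->
  2 < beta.
Proof.
move=> b1 L2 h; have b0 : 0 < beta by lra.
have L0 : 0 < L by lra.
have lnb := ln_ge_1subV b0; have lnL := ln_ge_1subV L0.
have LV : L^-1 < 2^-1 by rewrite ltf_pV2 ?posrE; lra.
have bV := mulfV (lt0r_neq0 b0).
rewrite ltNge; apply/negP => b2.
(* The logarithm bounds give beta + 2/beta > 3, that is (beta - 1)(beta - 2) > 0, which excludes 1
   <= beta <= 2. *)
have : beta * 3 < beta * (beta + 2 * beta^-1) by rewrite ltr_pM2l//; lra.
by rewrite [ltRHS]mulrDr (mulrCA beta) bV; nra.
Qed.

(** Since e^(-x) >= 1 - x, e^x <= 1/(1 - x); and (1 - x)(1 + x + 2 x^2) = 1 + x^2 (1 - 2 x) >= 1. *)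
Lemma expR_le_quadratic x : x <= 2^-1 -> expR x <= 1 + x + 2 * x ^+ 2.
Proof.
move=> x2; have := expRxMexpNx_1 x; have := expR_ge1Dx (- x).
have := expR_gt0 x; set a := expR x; set b := expR (- x) => a0 xb ab.
have a1x : a * (1 - x) <= 1 by rewrite -[leRHS]ab ler_pM2l.
have x1 : 0 < 1 - x by lra.
rewrite -(ler_pM2r x1); apply: le_trans a1x _.
have : 0 <= x ^+ 2 * (1 - 2 * x) by rewrite mulr_ge0 ?sqr_ge0//; lra.
by lra.
Qed.

(** By the quadratic bound the moment at t is at most 1 - t delta + 2 t^2. The choice t = delta/4
    minimises this and keeps t X below 1/2. *)
Lemma exp_moment_le (I : finType) (p X : I -> R) delta :
  (forall i, 0 <= p i) -> \sum_i p i = 1 -> (forall i, `|X i| <= 1) ->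
  0 <= delta <= 1 -> \sum_i p i * X i <= - delta ->
  \sum_i p i * expR (delta / 4 * X i) <= 1 - delta ^+ 2 / 8.
Proof.
move=> p0 p1 X1 /andP[d0 d1] EX.
apply: (@le_trans _ _ (\sum_i (p i * (1 + delta ^+ 2 / 8) + delta / 4 * (p i * X i)))).
  apply: ler_sum => i _.
  rewrite mulrCA -mulrDr ler_wpM2l//.
  have /ler_normlP[X1' X1''] := X1 i.
  apply: le_trans (@expR_le_quadratic _ _) _; first nra.
  have : X i ^+ 2 <= 1 by rewrite -real_normK ?num_real// expr_le1.
  rewrite exprMn; have := sqr_ge0 (delta / 4); nra.
rewrite big_split /= -mulr_suml -mulr_sumr p1 mul1r.
have : delta * (\sum_i p i * X i) <= delta * - delta by rewrite ler_wpM2l.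
rewrite mulrN -expr2; lra.
Qed.

Lemma geometric_eventually_le (c rho eps : R) : 0 <= rho < 1 -> 0 < eps -> 
  \forall n \near \oo, c * rho ^+ n.+1 <= eps.
Proof.
move=> /andP[r0 r1] e0.
have : (fun n => c * rho ^+ n.+1) @ \oo --> c * 0.
  apply: cvgMr; rewrite cvg_shiftS /=; apply: cvg_expr; rewrite ger0_norm//.
rewrite mulr0 => /cvgrPdist_lt/(_ _ e0); apply: filterS => n.
by rewrite sub0r normrN => /ltW/(le_trans (ler_norm _)).
Qed.

End numerics.

Lemma le_limn_esup (R : realType) (u : (\bar R)^nat) (l : \bar R) :
  (\forall n \near \oo, (l <= u n)%E) -> (l <= limn_esup u)%E.
Proof.
move=> [N _ lu]; apply: le_ereal_inf_tmp => /= _ [A [M /= _ MA] <-].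
apply: (@le_trans _ _ (u (maxn N M))); first by apply: lu; exact: leq_maxl.
by apply: ereal_sup_ubound; exists (maxn N M) => //; apply: MA; exact: leq_maxr.
Qed.

(** * Utility of the winner *)

Section util_ratio.
Context {R : realType}.
Local Open Scope ereal_scope.

Lemma le_util_ratio (c x0 y : R) (x : \bar R) : (0 < x0)%R -> (0 <= y)%R ->
  (c * y <= x0)%R -> x0%:E <= x -> c%:E <= util_ratio x y%:E.
Proof.
move=> x0_gt0 y0 cy x0x; have x_gt0 : 0 < x by apply: lt_le_trans x0x.
rewrite /util_ratio (gt_eqF x_gt0) /=.
(* If [y] is 0 the ratio is +oo, because [x] is positive; the 0/0 convention is never reached. *)
have [->|yn0] := eqVneq y 0%R; first by rewrite inve0 gt0_muley// leey.
have y_gt0 : (0 < y)%R by rewrite lt_neqAle eq_sym yn0.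
rewrite inver (negbTE yn0); apply: (@le_trans _ _ (x0%:E * (y^-1)%:E)).
  by rewrite -EFinM lee_fin ler_pdivlMr.
by rewrite lee_wpmul2r// lee_fin invr_ge0.
Qed.

End util_ratio.

Section conditional_utility.
Variables (R : realType) (n : nat) (beta : R).
Local Notation m := n.+1.
Implicit Types (u : m.-tuple R) (r : ranking m) (a t : R).

Lemma plackett_luceE u r :
  plackett_luce beta u r = ranking_weight (fun j => expR (beta * tnth u j)) r.
Proof. by []. Qed.

Lemma plackett_luce_ge0 u r : 0 <= plackett_luce beta u r.
Proof. by rewrite plackett_luceE; apply: ranking_weight_ge0 => j; exact: expR_ge0. Qed.

Lemma sum_plackett_luce u : \sum_r plackett_luce beta u r = 1.
Proof.
by apply: (@sum_ranking_weight _ _ (fun j => expR (beta * tnth u j))) => j; exact: expR_gt0.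
Qed.

(** The denominator of the top draw is bounded below by its single term for [j]. *)
Lemma plackett_luce_first u g j :
  \sum_r plackett_luce beta u r * (r ord0 == g)%:R <=
  expR (beta * (tnth u g - tnth u j)).
Proof.
under eq_bigr do rewrite plackett_luceE.
rewrite sum_ranking_weight_first => [|i]; last exact: expR_gt0.
have S_ge : expR (beta * tnth u j) <= \sum_l expR (beta * tnth u l).
  by rewrite (bigD1 j)//= lerDl sumr_ge0// => l _; exact: expR_ge0.
rewrite ler_pdivrMr; last exact: lt_le_trans (expR_gt0 _) S_ge.
apply: le_trans (ler_wpM2l (expR_ge0 _) S_ge).
by rewrite -expRD -mulrDr subrK.
Qed.

(* Summed over the voters, the increments of j = ord0 are nonnegative whenever
   ord0 wins, and those of j != ord0 are whenever the mean utility of j reaches a. *)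
Definition increment a (j : 'I_m) u r : R :=
  if j == ord0 then (r ord0 == ord0)%:R - (r ord_max == ord0)%:R
  else tnth u j - a.

(** If the winner's mean utility exceeds [a], its increments have nonnegative sum, so its
    exponential is at least 1 and dominates any mean utility. Summing over all candidates removes
    the dependence on who wins. *)
Lemma winner_utility_le m_gt0 order N (p : profile m N.+1)
    (us : N.+1.-tuple (m.-tuple R)) a t :
  (forall i, unit_cube (tnth us i)) -> 0 <= a -> 0 <= t ->
  mean_util us (plurality_veto m_gt0 order p) <=
  a + \sum_(j < m) \prod_(i < N.+1) expR (t * increment a j (tnth us i) (p i)).
Proof.
move=> us01 a0 t0; set j := plurality_veto _ _ _.
have N0 : 0 < N.+1%:R :> R by [].
have mean1 : mean_util us j <= 1.
  rewrite /mean_util ler_pdivrMl// mulr1 -[X in _ <= X%:R]card_ord -sum1_card natr_sum.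
  by apply: ler_sum => i _; have /andP[] := us01 i j.
have term0 l : 0 <= \prod_(i < N.+1) expR (t * increment a l (tnth us i) (p i)).
  by apply: prodr_ge0 => i _; exact: expR_ge0.
suff : a < mean_util us j ->
    1 <= \prod_(i < N.+1) expR (t * increment a j (tnth us i) (p i)).
  have [le_a _|_ /(_ erefl) ge1] := leP (mean_util us j) a.
    by rewrite (le_trans le_a)// lerDl sumr_ge0.
  by rewrite (le_trans mean1)// (bigD1 j)//= ler_wpDl// ler_wpDr// sumr_ge0.
move=> lt_a; rewrite -expR_sum -mulr_sumr -expR0 ler_expR mulr_ge0//.
rewrite /increment; case: eqVneq => [j0|_].
  rewrite sumrB subr_ge0 -!natr_sum ler_nat.
  by apply: plurality_veto_wins (m_gt0) (order) _ _ _ _; exact: j0.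
rewrite sumrB sumr_const card_ord subr_ge0 -mulr_natl -ler_pdivlMl//.
exact: ltW.
Qed.

Lemma sum_profile_prod N (G : 'I_N -> ranking m -> R) :
  \sum_(p : profile m N) \prod_(i < N) G i (p i) = \prod_(i < N) \sum_r G i r.
Proof. by rewrite bigA_distr_bigA. Qed.

(** Voters rank independently given the utilities, so the sum over profiles of each product of
    exponentials factors over the voters. *)
Lemma cond_util_rule_le m_gt0 order N (us : N.+1.-tuple (m.-tuple R)) a t :
  (forall i, unit_cube (tnth us i)) -> 0 <= a -> 0 <= t ->
  cond_util_rule beta (rule_of_deterministic R (plurality_veto m_gt0 order)) us <=
  a + \sum_(j < m) \prod_(i < N.+1)
    \sum_r plackett_luce beta (tnth us i) r * expR (t * increment a j (tnth us i) r).
Proof.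
move=> us01 a0 t0; rewrite /cond_util_rule.
apply: (@le_trans _ _ (\sum_(p : profile m N.+1)
    \prod_(i < N.+1) plackett_luce beta (tnth us i) (p i) *
    (a + \sum_(j < m) \prod_(i < N.+1) expR (t * increment a j (tnth us i) (p i))))).
  apply: ler_sum => p _; apply: ler_wpM2l.
    by apply: prodr_ge0 => i _; exact: plackett_luce_ge0.
  rewrite (bigD1 (plurality_veto m_gt0 order p))//= eqxx mul1r.
  rewrite big1 ?addr0 => [|j /negbTE ->]; last by rewrite mul0r.
  exact: winner_utility_le.
under eq_bigr do rewrite mulrDr mulr_sumr.
rewrite big_split /= -mulr_suml exchange_big /=.
rewrite (sum_profile_prod (fun i => plackett_luce beta (tnth us i))).
rewrite big1 ?mul1r => [|i _]; last exact: sum_plackett_luce.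
rewrite lerD2l; apply: ler_sum => j _; rewrite -sum_profile_prod.
by under eq_bigr do rewrite -big_split.
Qed.

Lemma cond_util_rule_ge0 f N (us : N.+1.-tuple (m.-tuple R)) :
  (forall i, unit_cube (tnth us i)) -> 0 <= cond_util_rule beta f us.
Proof.
move=> us01; apply: sumr_ge0 => p _; apply: mulr_ge0.
  by apply: prodr_ge0 => i _; exact: plackett_luce_ge0.
apply: sumr_ge0 => j _; apply: mulr_ge0; first exact: lottery_ge0.
by apply: mulr_ge0; [rewrite invr_ge0|apply: sumr_ge0 => i _; have /andP[] := us01 i j].
Qed.

Lemma normr_increment_le1 a j u r :
  0 <= a <= 1 -> unit_cube u -> `|increment a j u r| <= 1.
Proof.
move=> /andP[a0 a1] /(_ j)/andP[u0 u1]; rewrite /increment ler_norml.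
by case: (j == ord0); [case: (_ == _); case: (_ == _) => /=|]; lra.
Qed.

Variables (w : nat -> {nonneg R}) (v : nat -> m.-tuple R).
Hypothesis w_sum1 : \sum_(k < m) (w k)%:num = 1.
Hypothesis v_cube : forall k, (k < m)%N -> unit_cube (v k).

Let V := discrete_probability v w_sum1.

Lemma discrete_probability_unit_cube : V (@unit_cube R m) = 1%E.
Proof.
rewrite /V /= /discrete_prob_of /discrete_measure /msum /= -[RHS]/(1%:E) -w_sum1 -sumEFin.
apply: eq_bigr => k _; rewrite /mscale /= diracE mem_set ?mule1//.
exact: v_cube.
Qed.

Lemma util_cand_discrete j :
  util_cand V j = (\sum_(k < m) (w k)%:num * tnth (v k) j)%:E.
Proof.
rewrite /util_cand unlock integral_discrete// => [|k /v_cube/(_ j)/andP[]//].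
exact: measurable_tnth.
Qed.

Lemma util_rule_discrete f N :
  util_rule beta V f N = (iid_sum m w v (@cond_util_rule R m beta f N))%:E.
Proof.
rewrite /util_rule unlock integral_iid//; first exact: measurable_cond_util_rule.
move=> us us_v; apply: cond_util_rule_ge0 => i.
by have [k km ->] := us_v i; exact: v_cube.
Qed.

Lemma iid_sum_cond_util_ge0 f N : 0 <= iid_sum m w v (@cond_util_rule R m beta f N).
Proof.
rewrite -[leLHS](iid_sum_cst v w_sum1 N.+1); apply: le_iid_sum => us us_v.
by apply: cond_util_rule_ge0 => i; have [k km ->] := us_v i; exact: v_cube.
Qed.

(** A drift of at most - delta bounds each one-voter exponential moment by 1 - delta^2/8;
    independence raises it to the power N + 1, and the candidates are added up. *)
Lemma iid_sum_plurality_veto_le m_gt0 order N a delta :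
  0 <= a <= 1 -> 0 <= delta <= 1 ->
  (forall j, \sum_(k < m) (w k)%:num *
     \sum_r plackett_luce beta (v k) r * increment a j (v k) r <= - delta) ->
  iid_sum m w v (@cond_util_rule R m beta
    (rule_of_deterministic R (plurality_veto m_gt0 order)) N) <=
  a + m%:R * (1 - delta ^+ 2 / 8) ^+ N.+1.
Proof.
move=> a01 d01 drift; have /andP[a0 _] := a01; have /andP[d0 _] := d01.
apply: (@le_trans _ _ (iid_sum m w v (fun us : N.+1.-tuple _ =>
    a + \sum_(j < m) 1 * \prod_(i < N.+1) \sum_r plackett_luce beta (tnth us i) r *
      expR (delta / 4 * increment a j (tnth us i) r)))).
  apply: le_iid_sum => us us_v; under eq_bigr do rewrite mul1r.
  apply: cond_util_rule_le => // [i|]; last by rewrite divr_ge0.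
  by have [k km ->] := us_v i; exact: v_cube.
rewrite iid_sumD iid_sum_cst// lerD2l iid_sum_sum.
suff bound j : iid_sum m w v (fun us : N.+1.-tuple _ =>
    1 * \prod_(i < N.+1) \sum_r plackett_luce beta (tnth us i) r *
      expR (delta / 4 * increment a j (tnth us i) r)) <= (1 - delta ^+ 2 / 8) ^+ N.+1.
  by apply: le_trans (ler_sum _ (fun j _ => bound j)) _; rewrite sumr_const card_ord mulr_natl.
rewrite (iid_sum_prod m w v N.+1 1 (fun u => \sum_r plackett_luce beta u r *
  expR (delta / 4 * increment a j u r))) mul1r.
have h0 : 0 <= \sum_(k < m) (w k)%:num * \sum_r plackett_luce beta (v k) r *
    expR (delta / 4 * increment a j (v k) r).
  apply: sumr_ge0 => k _; rewrite mulr_ge0// sumr_ge0// => r _.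
  by rewrite mulr_ge0 ?expR_ge0 ?plackett_luce_ge0.
(* Type and ranking of a voter are treated as one finite random variable, to which [exp_moment_le]
   applies. *)
have pairE (F : 'I_m -> ranking m -> R) :
    \sum_(k < m) (w k)%:num * \sum_r plackett_luce beta (v k) r * F k r =
    \sum_(x : 'I_m * ranking m)
      (w x.1)%:num * plackett_luce beta (v x.1) x.2 * F x.1 x.2.
  rewrite -(pair_bigA _ (fun (k : 'I_m) (r : ranking m) => (w k)%:num * plackett_luce beta (v k) r * F k r)) /=.
  by apply: eq_bigr => k _; rewrite mulr_sumr; apply: eq_bigr => r _; rewrite mulrA.
apply: lerXn2r; rewrite ?nnegrE//; first nra.
rewrite (pairE (fun (k : 'I_m) (r : ranking m) => expR (delta / 4 * increment a j (v k) r))).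
apply: exp_moment_le => //.
- by move=> x; rewrite mulr_ge0 ?plackett_luce_ge0.
- rewrite -(pair_bigA _ (fun (k : 'I_m) (r : ranking m) => (w k)%:num * plackett_luce beta (v k) r)) /=.
  by under eq_bigr do rewrite -mulr_sumr sum_plackett_luce mulr1.
- by move=> x; apply: normr_increment_le1 => //; exact: v_cube.
- by rewrite -(pairE (fun (k : 'I_m) (r : ranking m) => increment a j (v k) r)); exact: drift.
Qed.

End conditional_utility.

(** * The bad electorate *)

Section two_type_electorate.
Variables (R : realType) (n : nat) (beta q : R).
Hypotheses (n_gt0 : (0 < n)%N) (q01 : 0 <= q <= 1).
Local Notation m := n.+1.

(** Types are indexed like candidates: type 0 dislikes candidate 0, and type k > 0 favours candidate
    k. The law thus has as many atoms as there are candidates. *)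
Definition type_weight (k : nat) : R := if k is 0 then q else (1 - q) / n%:R.

Definition type_utility (k j : nat) : R :=
  if k is 0 then (j != 0)%:R else if j is 0 then 2^-1 else (j == k)%:R.

Lemma type_weight_ge0 k : 0 <= type_weight k.
Proof. by move: q01 => /andP[q0 q1]; case: k => //= k; rewrite divr_ge0// subr_ge0. Qed.

Definition type_nonneg k : {nonneg R} := NngNum (type_weight_ge0 k).

Definition type_tuple (k : nat) : m.-tuple R := [tuple type_utility k j | j < m].

Lemma tnth_type_tuple k j : tnth (type_tuple k) j = type_utility k j.
Proof. by rewrite tnth_mktuple. Qed.

Lemma sum_type_weight (F : nat -> R) :
  \sum_(k < m) (type_nonneg k)%:num * F k = 
  q * F 0 + (1 - q) / n%:R * \sum_(k < n) F k.+1.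
Proof. by rewrite big_ord_recl mulr_sumr. Qed.

Lemma type_weight_sum1 : \sum_(k < m) (type_nonneg k)%:num = 1.
Proof.
rewrite (eq_bigr (fun k : 'I_m => (type_nonneg k)%:num * 1)) => [|k _]; last by rewrite mulr1.
rewrite (sum_type_weight (fun=> 1)) sumr_const card_ord mulr1 divfK.
  by rewrite addrC subrK.
by rewrite pnatr_eq0 -lt0n.
Qed.

Lemma type_tuple_cube k : unit_cube (type_tuple k).
Proof.
move=> j; rewrite tnth_type_tuple /type_utility.
by case: k => [|k]; [|case: (val j) => [|l]]; try (case: (_ == _)) => /=; lra.
Qed.

Lemma mean_type_utility0 :
  \sum_(k < m) (type_nonneg k)%:num * tnth (type_tuple k) ord0 = (1 - q) / 2.
Proof.
under eq_bigr do rewrite tnth_type_tuple.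
rewrite (sum_type_weight (fun k => type_utility k 0)) /= sumr_const card_ord mulr0 add0r.
by rewrite -[2^-1 *+ n]mulr_natl mulrA divfK// pnatr_eq0 -lt0n.
Qed.

Lemma mean_type_utilityS (j : 'I_n) a :
  \sum_(k < m) (type_nonneg k)%:num * (tnth (type_tuple k) (lift ord0 j) - a) =
  q + (1 - q) / n%:R - a.
Proof.
under eq_bigr do rewrite mulrBr tnth_type_tuple.
rewrite sumrB -mulr_suml type_weight_sum1 mul1r; congr (_ - _).
rewrite (sum_type_weight (fun k => type_utility k (lift ord0 j))) /= mulr1.
congr (_ + _); rewrite (bigD1 j)//= eqxx big1 ?addr0 ?mulr1// => k kj.
by rewrite /bump /= eqSS (inj_eq val_inj) eq_sym (negbTE kj).
Qed.

Lemma type_first_le k : (k < m)%N -> 0 <= beta ->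
  \sum_r plackett_luce beta (type_tuple k) r * (r ord0 == ord0)%:R <= expR (- (beta / 2)).
Proof.
(* For type [k], candidate [j] has utility 1 and candidate 0 at most 1/2; [ord_max] differs from
   candidate 0 because [n] is positive. *)
move=> km b0; pose j : 'I_m := if k is 0 then ord_max else Ordinal km.
apply: le_trans (plackett_luce_first _ _ _ j) _.
rewrite ler_expR !tnth_type_tuple /type_utility /j.
case: k km {j} => [|k] km /=; last by rewrite eqxx mulr1n; lra.
by rewrite -lt0n n_gt0 mulr1n; lra.
Qed.

(** For type 0 every other candidate has e^beta times the weight of candidate 0, so
    [sum_ranking_weight_last] applies with W = e^beta. *)
Lemma type0_last_ge :
  1 - (1 + ln m%:R) / expR beta <=
  \sum_r plackett_luce beta (type_tuple 0) r * (r ord_max == ord0)%:R.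
Proof.
apply: le_trans (@sum_ranking_weight_last _ _
  (fun j => expR (beta * tnth (type_tuple 0) j)) ord0 _ (expR_gt0 beta) _ _); first last.
- move=> i i0; rewrite !tnth_type_tuple /= mulr0 expR0 mul1r.
  by move: i0; rewrite -val_eqE /= => ->; rewrite mulr1n mulr1.
- by move=> i; exact: expR_gt0.
- rewrite lerD2l lerN2 ler_pM2r ?invr_gt0 ?expR_gt0//.
  have := sum_inv_le_ln R n.-1; rewrite prednK// => /le_trans; apply.
  by rewrite lerD2l ler_ln ?posrE ?ltr0n// ler_nat.
Qed.

End two_type_electorate.

(** * Choice of constants and the lower bound *)

Section lower_bound.
Variables (R : realType) (n : nat) (beta : R).
Local Notation m := n.+1.
Local Notation L := (ln m%:R : R).
Hypotheses (m_ge10 : (10 <= m)%N) (beta_ge1 : 1 <= beta)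
  (beta_le : beta <= m%:R / (3 * L)) (beta_ge : 2 * ln beta + 2 * ln L <= beta).

Let B := beta * L.
(** Large enough for vetoes to beat first places, 1/B - (13/16) q = -7/(32 B) <= - eps, and small
    enough for [mean_bound]. Below, [eps] is the gap in [a], the drift and the final error. *)
Let q := 3 / 2 / B.
Let eps := (16 * B)^-1.
Let a := q + (1 - q) / n%:R + eps.

Let L_gt2 : 2 < L. Proof. exact: ln_nat_gt2. Qed.

Let B_ge4 : 4 <= B.
Proof. by have := two_lt_beta beta_ge1 L_gt2 beta_ge; rewrite /B; have := L_gt2; nra. Qed.

(** From 3 B <= m = n + 1 and n >= 9 one gets 3 B <= 10 n / 9. *)
Let B_le : B <= 10 / 27 * n%:R.
Proof.
have L0 : 0 < L by have := L_gt2; lra.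
have : beta * (3 * L) <= m%:R by rewrite -ler_pdivlMr// mulr_gt0.
have : 9 <= n%:R :> R by rewrite ler_nat.
by rewrite /B -(natr1 n); lra.
Qed.

Let expR_half : B <= expR (beta / 2).
Proof. by apply: expR_half_ge => //; [have := beta_ge1|have := L_gt2]; lra. Qed.

(** Here e^beta >= B^2 >= 4 L^2, and (1 + L)/(4 L^2) <= 3/16 for L >= 2, with equality at L = 2. *)
Let last_ge : 13 / 16 <= 1 - (1 + L) / expR beta.
Proof.
have b2 := two_lt_beta beta_ge1 L_gt2 beta_ge; have l2 := L_gt2.
have eB : B ^+ 2 <= expR beta.
  have -> : expR beta = expR (beta / 2) ^+ 2 by rewrite -expRM_natl; congr expR; field.
  by rewrite lerXn2r ?nnegrE ?expR_ge0//; have := B_ge4; lra.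
have B2 : 4 * L ^+ 2 <= B ^+ 2.
  rewrite /B exprMn ler_pM2r ?exprn_gt0//; last lra.
  by rewrite !expr2; nra.
suff : (1 + L) / expR beta <= 3 / 16 by lra.
by rewrite ler_pdivrMr ?expR_gt0//; move: eB B2; rewrite !expr2; nra.
Qed.

Let BV : B * B^-1 = 1. Proof. by rewrite divff// gt_eqF//; have := B_ge4; lra. Qed.
Let BV0 : 0 < B^-1. Proof. by rewrite invr_gt0; have := B_ge4; lra. Qed.
Let epsE : eps = B^-1 / 16. Proof. by rewrite /eps invfM mulrC. Qed.
Let qE : q = 3 / 2 * B^-1. Proof. by []. Qed.
Let BV_le : B^-1 <= 4^-1.
Proof. by rewrite lef_pV2 ?posrE//; have := B_ge4; lra. Qed.

Let q01 : 0 <= q <= 1.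
Proof. by rewrite qE; have := BV0; have := BV_le; lra. Qed.

Let n_gt0 : (0 < n)%N. Proof. by rewrite -ltnS; exact: leq_trans m_ge10. Qed.

Let nV0 : 0 < n%:R^-1 :> R. Proof. by rewrite invr_gt0 ltr0n. Qed.
Let nV_le : n%:R^-1 <= 10 / 27 * B^-1.
Proof.
have n0 : 0 < n%:R :> R by rewrite ltr0n.
by rewrite -div1r ler_pdivrMr// mulrAC ler_pdivlMr ?mul1r//; have := B_ge4; lra.
Qed.

Let a_bounds : 0 <= a <= 1.
Proof.
rewrite /a epsE qE; have := BV0; have := BV_le; have := nV0; have := nV_le.
set x := B^-1; set y := n%:R^-1 => *; nra.
Qed.

(** B (a + eps) = 3/2 + (1 - q) B/n + 1/8 with B/n <= 10/27. What remains is 13/48 + (5/81)(1 - q)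
    <= (1 - q)/2, true because B >= 4 gives q <= 3/8. *)
Let mean_bound : B / 6 * (a + eps) <= (1 - q) / 2.
Proof.
rewrite /a epsE qE; have := BV; have := BV0; have := BV_le; have := nV0; have := nV_le.
have := B_ge4; set x := B^-1; set y := n%:R^-1 => B4 ny y0 x4 x0 Bx.
have By : B * y <= 10 / 27 by rewrite (le_trans (ler_wpM2l _ ny))//; nra.
have : B * y * (1 - 3 / 2 * x) <= 10 / 27 * (1 - 3 / 2 * x) by rewrite ler_wpM2r//; lra.
have -> : B / 6 * (3 / 2 * x + (1 - 3 / 2 * x) * y + x / 16 + x / 16) =
  (B * x) * (13 / 48) + B * y * (1 - 3 / 2 * x) / 6 by field.
rewrite Bx; lra.
Qed.

Let w k := type_nonneg n q01 k.
Let v := type_tuple R n.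

Let drift (j : 'I_m) : \sum_(k < m) (w k)%:num *
     \sum_r plackett_luce beta (v k) r * increment a j (v k) r <= - eps.
Proof.
have [j' ->|->] := unliftP ord0 j.
  rewrite (eq_bigr (fun k : 'I_m => (w k)%:num * (tnth (v k) (lift ord0 j') - a))).
    by rewrite mean_type_utilityS// /a; lra.
  move=> k _; congr (_ * _); rewrite /increment /=.
  by rewrite -mulr_suml sum_plackett_luce mul1r.
(* Candidate 0: every type puts it first with probability at most 1/B, and only the last places
   given by type 0 are counted against it. *)
have b0 : 0 <= beta by have := beta_ge1; lra.
have incE k : \sum_r plackett_luce beta (v k) r * increment a ord0 (v k) r =
    \sum_r plackett_luce beta (v k) r * (r ord0 == ord0)%:R -
    \sum_r plackett_luce beta (v k) r * (r ord_max == ord0)%:R.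
  by rewrite -sumrB; apply: eq_bigr => r _; rewrite /increment eqxx mulrBr.
have first_le k : (k < m)%N ->
    \sum_r plackett_luce beta (v k) r * (r ord0 == ord0)%:R <= B^-1.
  move=> km; apply: le_trans (type_first_le n_gt0 km b0) _.
  by rewrite expRN lef_pV2// posrE ?expR_gt0//; have := B_ge4; lra.
rewrite (sum_type_weight n q01 (fun k => \sum_r plackett_luce beta (v k) r * increment a ord0 (v k) r)).
have drift0 : \sum_r plackett_luce beta (v 0%N) r * increment a ord0 (v 0%N) r <= B^-1 - 13 / 16.
  by rewrite incE lerB ?first_le// (le_trans last_ge)// type0_last_ge.
have driftS : \sum_(k < n) \sum_r plackett_luce beta (v k.+1) r * increment a ord0 (v k.+1) r
    <= n%:R * B^-1.
  rewrite mulr_natl -[n in X in _ <= X]card_ord -sumr_const; apply: ler_sum => k _.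
  rewrite incE lerBlDr (le_trans (first_le _ _)) ?ltnS// lerDl sumr_ge0// => r _.
  by rewrite mulr_ge0 ?plackett_luce_ge0.
have /andP[q0 q1] := q01.
apply: (@le_trans _ _ (q * (B^-1 - 13 / 16) + (1 - q) / n%:R * (n%:R * B^-1))).
  by apply: lerD; apply: ler_wpM2l => //; rewrite divr_ge0// subr_ge0.
rewrite mulrA divfK ?pnatr_eq0 -?lt0n// epsE qE; have := BV0; lra.
Qed.

Lemma plurality_veto_distortion_ge (m_gt0 : (0 < m)%N) (order : forall N, 'S_N.+1) :
  ((beta * L / 6)%:E <=
    distortion beta (rule_of_deterministic R (plurality_veto m_gt0 order)))%E.
Proof.
have w_sum1 := type_weight_sum1 n_gt0 q01.
have v_cube k (_ : (k < m)%N) : unit_cube (v k) by exact: type_tuple_cube.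
pose V := discrete_probability v w_sum1.
apply: (@le_trans _ _ (asymptotic_ratio beta
    (rule_of_deterministic R (plurality_veto m_gt0 order)) V)); last first.
  by apply: ereal_sup_ubound; exists V => //; exact: discrete_probability_unit_cube.
have eps0 : 0 < eps by rewrite epsE; have := BV0; lra.
have eps1 : 0 <= eps <= 1 by rewrite epsE; have := BV0; have := BV_le; lra.
apply: le_limn_esup.
have rho01 : 0 <= 1 - eps ^+ 2 / 8 < 1.
  have : 0 < eps ^+ 2 by rewrite exprn_gt0.
  have : eps ^+ 2 <= 1 by rewrite expr_le1//; lra.
  lra.
(* Eventually the error term is at most [eps], so the rule earns at most [a + eps]. *)
apply: filterS (geometric_eventually_le m%:R rho01 eps0) => N err_le.
rewrite util_rule_discrete//.
have util_le := iid_sum_plurality_veto_le w_sum1 v_cube m_gt0 order N a_bounds eps1 drift.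
(* The numerator is bounded below by the expected utility of candidate 0. *)
apply: (@le_util_ratio _ _ ((1 - q) / 2)).
- by rewrite qE; have := BV_le; lra.
- exact: iid_sum_cond_util_ge0.
- apply: le_trans mean_bound; apply: ler_wpM2l; first by have := B_ge4; rewrite /B; lra.
  by apply: le_trans util_le _; rewrite lerD2l.
- rewrite (bigD1 ord0)//= le_max util_cand_discrete//.
  by rewrite -(mean_type_utility0 n_gt0 q01) lexx.
Qed.

End lower_bound.

Theorem theorem5p1 (R : realType) (m : nat) (beta : R)
    (order : forall n, 'S_n.+1)
    (m_ge10 : (10 <= m)%N)
    (beta_ge1 : 1 <= beta)
    (beta_le : beta <= m%:R / (3 * ln m%:R))
    (beta_ge : 2 * ln beta + 2 * ln (ln m%:R) <= beta) :
  ((beta * ln m%:R / 6)%:E <=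
    distortion beta (rule_of_deterministic R
      (plurality_veto (leq_trans (ltn0Sn 9) m_ge10) order)))%E.
Proof.
move: (leq_trans _ m_ge10) => m_gt0; case: m => [//|n] in m_ge10 beta_le beta_ge m_gt0 *.
exact: plurality_veto_distortion_ge.
Qed.
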